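(* Let $q=p^n$ be a prime power, $\rho$ a generator of $\mathbb{F}_q^*$, and let $(a_{11},a_{12}),(a_{21},a_{22}),(a_{31},a_{32})$ be non-collinear exponent vectors, with $\mathcal{C}_{ij}^*$, $d,e,f,k,w,\tilde g$, $D_\ell$ and $N_{ij}$ as defined in the context. Then $$|N_{ij}|\le 2\tilde g\sqrt{q}\qquad\text{for all } i,j.$$
   Context: Let $p$ be a prime, $q=p^n$ with $n\ge 1$, and $\rho$ a generator of the cyclic group $\mathbb{F}_q^*$. Let $a_{rs}$ ($1\le r\le 3$, $1\le s\le 2$) be non-negative integers such that the three vectors $(a_{r1},a_{r2})$ are not collinear, i.e. the integer matrix $$B=\begin{bmatrix} b_{11}&b_{12}\\ b_{21}&b_{22}\end{bmatrix}:=\begin{bmatrix} a_{11}-a_{31}&a_{12}-a_{32}\\ a_{21}-a_{31}&a_{22}-a_{32}\end{bmatrix}$$ satisfies $\det(B)\ne 0$. For integers $i,j$ (only their classes modulo $q-1$ matter) let $$\mathcal{C}_{ij}^*=\{(x,y)\in(\mathbb{F}_q^* )^2 : \rho^i x^{a_{11}}y^{a_{12}}+\rho^j x^{a_{21}}y^{a_{22}}=x^{a_{31}}y^{a_{32}}\}.$$ Constants: $d=\gcd(b_{11},b_{12},q-1)$, $e=\gcd(b_{21},b_{22},q-1)$, $f=\gcd(b_{11}-b_{21},b_{12}-b_{22},q-1)$, $k=\gcd((q-1)\gcd(d,e,f),\det(B))$ (all gcds positive), $w=0$ if $q$ is even and $w=\frac{q-1}{2}$ if $q$ is odd, and $\tilde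 g=\frac12(k-d-e-f+2)$. For a positive integer $\ell$ and an integer $i$, $D_\ell(i)=\ell$ if $\ell\mid i$ and $D_\ell(i)=0$ otherwise. The integers $N_{ij}$ are defined by $$|\mathcal{C}_{ij}^*| = q+1-D_d(i)-D_e(j)-D_f(i-j+w)+N_{ij}.$$ *)

(* Defs.v *)
From HB Require Import structures.
From mathcomp Require Import all_boot all_order all_fingroup all_algebra.
From mathcomp Require Import all_solvable.

Set Implicit Arguments.
Unset Strict Implicit.
Unset Printing Implicit Defensive.

Import Order.TTheory GRing.Theory Num.Theory.
Local Open Scope ring_scope.

(* Throughout, row r of a : 'M[nat]_(3, 2) is the exponent vector
   (a_{r+1,1}, a_{r+1,2}); indices start at 0. *)

(* [lift ord_max] embeds 'I_2 into 'I_3 as the indices 0 and 1. *)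
Definition expB (a : 'M[nat]_(3, 2)) : 'M[int]_2 :=
  \matrix_(r, s) ((a (lift ord_max r) s)%:Z - (a ord_max s)%:Z).

Definition noncollinear (a : 'M[nat]_(3, 2)) : bool := \det (expB a) != 0.

Section Constants.
Variables (q : nat) (a : 'M[nat]_(3, 2)).
Let b := expB a.

Definition const_d : int := gcdz (gcdz (b 0 0) (b 0 1)) (q%:Z - 1).
Definition const_e : int := gcdz (gcdz (b 1 0) (b 1 1)) (q%:Z - 1).
Definition const_f : int :=
  gcdz (gcdz (b 0 0 - b 1 0) (b 0 1 - b 1 1)) (q%:Z - 1).
Definition const_k : int :=
  gcdz ((q%:Z - 1) * gcdz (gcdz const_d const_e) const_f) (\det b).
Definition const_w : int := if odd q then ((q%:Z - 1) %/ 2)%Z else 0.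

(* A priori only a half-integer, hence a rational. *)
Definition gtilde : rat :=
  (const_k - const_d - const_e - const_f + 2)%:~R / 2.

End Constants.

Definition Dfun (l i : int) : int := if (l %| i)%Z then l else 0.

Definition curveC (F : finFieldType) (rho : {unit F}) (a : 'M[nat]_(3, 2))
    (i j : int) : {set {unit F} * {unit F}} :=
  [set z | val rho ^ i * val z.1 ^+ a 0 0 * val z.2 ^+ a 0 1
           + val rho ^ j * val z.1 ^+ a 1 0 * val z.2 ^+ a 1 1
           == val z.1 ^+ a ord_max 0 * val z.2 ^+ a ord_max 1].

Definition mainterm (q : nat) (a : 'M[nat]_(3, 2)) (i j : int) : int :=
  q%:Z + 1 - Dfun (const_d q a) i - Dfun (const_e q a) j
  - Dfun (const_f q a) (i - j + const_w q).

Definition Nerr (F : finFieldType) (rho : {unit F}) (a : 'M[nat]_(3, 2))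
    (i j : int) : int :=
  #|curveC rho a i j|%:Z - mainterm #|F| a i j.

Lemma card_curveC (F : finFieldType) (rho : {unit F}) (a : 'M[nat]_(3, 2))
    (i j : int) :
  #|curveC rho a i j|%:Z = mainterm #|F| a i j + Nerr rho a i j.
Proof. by rewrite /Nerr addrC subrK. Qed.

Lemma expB_rows (a : 'M[nat]_(3, 2)) s :
  expB a 0 s = (a 0 s)%:Z - (a 2 s)%:Z /\ expB a 1 s = (a 1 s)%:Z - (a 2 s)%:Z.
Proof.
rewrite !mxE; split; congr (Posz (a _ s) - Posz (a _ s)); exact: val_inj.
Qed.

(* Main.v *)
Require Import Defs.
From HB Require Import structures.
From mathcomp Require Import all_boot all_order all_fingroup all_algebra.
From mathcomp Require Import all_solvable all_field.
From mathcomp Require Import ring.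

Set Implicit Arguments.
Unset Strict Implicit.
Unset Printing Implicit Defensive.

Import Order.TTheory GRing.Theory Num.Theory.
Local Open Scope ring_scope.

(** Put N = q - 1 and write x = rho ^ s, y = rho ^ t with s, t in Z/N.  Dividing
    the equation by its right-hand side turns it into
      rho ^ (i + b11 s + b12 t) + rho ^ (j + b21 s + b22 t) = 1.
    Fix a primitive N-th root of unity; it indexes the multiplicative characters
    of F by Z/N.  Detecting the two powers of rho by orthogonality of characters
    gives (count_points)
      |C_ij| = sum over (al, be) in H of
               X_al(rho ^ -i) X_be(rho ^ -j) J(X_al, X_be),
    where H is the group of the pairs with (al, be) B = 0 in (Z/N)^2 and
    J(X, Y) = sum_x X(x) Y(1 - x) is the Jacobi sum.

    Jacobi sums are elementary on the three lines al = 0, be = 0, al + be = 0: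
    J is q - 2 at the origin and -1, -1, -X_al(-1) elsewhere on the lines.
    Each line meets H in a group of order d, e or f, over which the characters
    sum to D_d(i), D_e(j) or D_f(i - j + w); with q + 1 for the correction at
    the origin, common to the three lines, this produces the main term.  Off
    the lines |J| = sqrt q (jacobi_sum_sqr_norm), which follows from a Moebius
    substitution, without Gauss sums.  So N_ij has absolute value at most sqrt q
    times the number |H| - d - e - f + 2 of pairs of H off the lines.  Finally
    |H| = k (card_ker2): by the Smith normal form of B, with diagonal s1 | s2,
    one has |H| = gcd(s1, N) gcd(s2, N) = gcd(N gcd(s1, N), s1 s2).

    The estimate is proved in the field of algebraic numbers; both sides of its
    square are integers, so that it holds in every real closed field. *)

(** * Jacobi sums over a finite field *)

(** Multiplicative characters of a finite field, extended by 0 at 0; so the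
    trivial character is the indicator function of the nonzero elements. *)
Definition mulchar (F : finFieldType) (X : F -> algC) : Prop :=
  [/\ X 0 = 0, X 1 = 1 & {morph X : x y / x * y}].

(** The sum of X x * Y y over the pairs with x + y = 1. *)
Definition jacobi_sum (F : finFieldType) (X Y : F -> algC) : algC :=
  \sum_x X x * Y (1 - x).

Section MulChar.
Variables (F : finFieldType).
Implicit Types (X Y : F -> algC) (x y : F).

Lemma mulcharXn X x m : mulchar X -> X (x ^+ m) = X x ^+ m.
Proof. by case=> _ X1 XM; elim: m => // m IH; rewrite !exprS XM IH. Qed.

Lemma mulchar_neq0 X x : mulchar X -> x != 0 -> X x != 0.
Proof.
move=> [X0 X1 XM] x0; apply/eqP => e.
by have := oner_neq0 algC; rewrite -X1 -(divff x0) XM e mul0r eqxx.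
Qed.

Lemma mulcharV X x : mulchar X -> X x^-1 = (X x)^-1.
Proof.
move=> hX; have [-> | x0] := eqVneq x 0.
  by case: hX => X0 _ _; rewrite invr0 X0 invr0.
apply: (mulfI (mulchar_neq0 hX x0)); rewrite divff ?mulchar_neq0 //.
by case: hX => _ X1 XM; rewrite -XM divff.
Qed.

Lemma mulchar_norm X x : mulchar X -> x != 0 -> `|X x| = 1.
Proof.
move=> hX x0.
have q1 := card_finNzRing_gt1 F.
have e : x ^+ #|F|.-1 = 1.
  by apply: (mulfI x0); rewrite -exprS mulr1 (ltn_predK q1) expf_card.
apply/eqP; rewrite -(@pexpr_eq1 _ _ #|F|.-1) -?subn1 ?subn_gt0 // subn1.
rewrite -normrX -mulcharXn // e.
by case: hX => _ -> _; rewrite normr1.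
Qed.

Lemma mulchar_conj X x : mulchar X -> (X x)^* = X x^-1.
Proof.
move=> hX; have [-> | x0] := eqVneq x 0.
  by case: hX => X0 _ _; rewrite invr0 X0 conjC0.
by rewrite mulcharV // invC_norm mulchar_norm // expr1n invr1 mul1r.
Qed.

Lemma mulcharM X Y : mulchar X -> mulchar Y -> mulchar (fun x => X x * Y x).
Proof.
move=> [X0 X1 XM] [_ Y1 YM]; split; first by rewrite X0 mul0r.
  by rewrite X1 Y1 mulr1.
by move=> x y; rewrite XM YM mulrACA.
Qed.

(** A sum over a nontrivial character is unchanged by multiplication by a
    value of the character other than 1. *)
Lemma sum_mulchar X y : mulchar X -> y != 0 -> X y != 1 -> \sum_x X x = 0.
Proof.
move=> [X0 X1 XM] y0 Xy.
have e : \sum_x X x = X y * \sum_x X x.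
  rewrite mulr_sumr (reindex_inj (mulfI y0)).
  by apply: eq_bigr => x _; rewrite XM.
apply/eqP; have : (1 - X y) * \sum_x X x = 0 by rewrite mulrBl mul1r -e subrr.
by move/eqP; rewrite mulf_eq0 subr_eq0 eq_sym (negbTE Xy).
Qed.

Lemma sum_mulcharD1 X y z : mulchar X -> y != 0 -> X y != 1 ->
  \sum_(x | x != z) X x = - X z.
Proof.
move=> hX y0 Xy; have := sum_mulchar hX y0 Xy.
by rewrite (bigD1 z) //= addrC => /eqP; rewrite addr_eq0 => /eqP.
Qed.

(** The Moebius map t |-> (1 - at)/(1 - t) is a bijection from the complement
    of 1 to the complement of a, when a <> 1. *)
Lemma sum_moebius X (a : F) : a != 1 ->
  \sum_(t | t != 1) X ((1 - a * t) / (1 - t)) = \sum_(v | v != a) X v.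
Proof.
move=> a1.
have sub0 (u v : F) : u != v -> v - u != 0 by rewrite subr_eq0 eq_sym.
have a1' : 1 - a != 0 := sub0 _ _ a1.
rewrite [RHS](reindex_onto (fun t => (1 - a * t) / (1 - t))
                           (fun v => (1 - v) / (a - v))) /=; last first.
  move=> v va; have av := sub0 _ _ va.
  have e : a - v - (1 - v) != 0.
    by rewrite opprB addrA subrK -opprB oppr_eq0.
  field; rewrite av /=; apply: contra e => /eqP e; apply/eqP.
  by move: e => <-; ring.
apply: eq_bigl => t; apply/idP/andP => [t1 | [_ /eqP e]].
  have t1' := sub0 _ _ t1; split.
    apply: contra a1' => /eqP /(canRL (divfK t1')) e; apply/eqP.
    have -> : 1 - a = (1 - a * t) - a * (1 - t) by ring.
    by rewrite e subrr.
  apply/eqP; field; rewrite t1' /=.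
  by apply: contra a1' => /eqP e; apply/eqP; rewrite -oppr0 -e; ring.
(* At t = 1 the quotient is 1 / 0 = 0, which the inverse map sends to 1 / a. *)
apply/eqP => t1; move: e; rewrite t1 subrr invr0 mulr0 !subr0 mul1r => e.
by move: a1; rewrite -[a]invrK e invr1 eqxx.
Qed.

(** X takes a value other than 1 on the nonzero elements. *)
Definition nontrivial_char X := exists2 y, y != 0 & X y != 1.

(** Here X is the trivial character. *)
Lemma jacobi_sum1r X Y : (forall x, x != 0 -> X x = 1) -> X 0 = 0 ->
  mulchar Y -> nontrivial_char Y -> jacobi_sum X Y = -1 /\ jacobi_sum Y X = -1.
Proof.
move=> X1 X0 hY [y y0 Yy].
have sumY : jacobi_sum Y X = -1.
  rewrite /jacobi_sum (bigD1 1) //= subrr X0 mulr0 add0r.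
  rewrite (eq_bigr Y) => [|x x1]; last by rewrite X1 ?mulr1 // subr_eq0 eq_sym.
  by rewrite (sum_mulcharD1 _ hY y0) //; case: hY => _ ->.
split=> //; rewrite -sumY /jacobi_sum (reindex_inj (subrI 1)) /=.
by apply: eq_bigr => x _; rewrite subKr mulrC.
Qed.

Lemma jacobi_sum_inv X Y : mulchar X -> nontrivial_char X ->
  (forall x, Y x = X x^-1) -> jacobi_sum X Y = - X (-1).
Proof.
move=> hX [y y0 Xy] YX; rewrite -(sum_mulcharD1 (-1) hX y0 Xy) /jacobi_sum.
have [X0 _ XM] := hX.
rewrite (bigD1 1) //= subrr YX invr0 X0 mulr0 add0r.
have sub1 (x : F) : x != 1 -> 1 - x != 0 by rewrite subr_eq0 eq_sym.
have addN1 (v : F) : v != -1 -> 1 + v != 0 by rewrite addrC addr_eq0.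
rewrite [RHS](reindex_onto (fun x => x / (1 - x)) (fun v => v / (1 + v))) /=.
  apply: eq_big => [x | x x1]; last by rewrite YX XM.
  apply/idP/andP => [/sub1 x1 | [_ /eqP e]].
    split; last by apply/eqP; field; rewrite x1 subrK oner_eq0.
    apply: contra (oner_neq0 F) => /eqP /(canRL (divfK x1)) e; apply/eqP.
    by have := subrr x; rewrite {2}e mulN1r opprB subKr.
  apply/eqP => x1; move: e; rewrite x1 subrr invr0 mulr0 mul0r => /eqP.
  by rewrite eq_sym oner_eq0.
by move=> v /addN1 v1; field; rewrite v1 addrK oner_neq0.
Qed.

(** |J(X, Y)|^2 = q.  In the double sum over (s, t), write s = at: the terms
    with a = 1 contribute q - 2, and for the other values of a the sum over t
    is evaluated by sum_moebius. *)
Lemma jacobi_sum_sqr_norm X Y : mulchar X -> mulchar Y ->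
    nontrivial_char X -> nontrivial_char Y ->
    nontrivial_char (fun x => X x * Y x) ->
  `|jacobi_sum X Y| ^+ 2 = #|F|%:R.
Proof.
move=> hX hY [x x0 Xx] [y y0 Yy] [z z0 XYz].
have hXY := mulcharM hX hY.
have [X0 X1 XM] := hX; have [Y0 Y1 YM] := hY.
have -> : `|jacobi_sum X Y| ^+ 2 =
    \sum_a X a * \sum_(t | (t != 0) && (t != 1)) Y ((1 - a * t) / (1 - t)).
  rewrite normCK rmorph_sum mulr_sumr /=.
  under [RHS]eq_bigr do rewrite mulr_sumr.
  rewrite exchange_big /= [RHS]big_mkcond /=; apply: eq_bigr => t _.
  case: ifP => [/andP[t0 t1] | t01]; last first.
    suff -> : X t * Y (1 - t) = 0 by rewrite conjC0 mulr0.
    have [-> | t0] := eqVneq t 0; first by rewrite X0 mul0r.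
    have [-> | t1] := eqVneq t 1; first by rewrite subrr Y0 mulr0.
    by rewrite t0 t1 in t01.
  rewrite /jacobi_sum mulr_suml (reindex_inj (mulIf t0)); apply: eq_bigr => a _.
  rewrite rmorphM /= !mulchar_conj // mulrACA -XM -YM.
  by rewrite mulfK.
rewrite (bigD1 1) //= X1 mul1r.
have -> : \sum_(t : F | (t != 0) && (t != 1)) Y ((1 - 1 * t) / (1 - t)) =
    #|F|%:R - 2.
  rewrite (eq_bigr (fun=> 1)); last first.
    by move=> t /andP[_ t1]; rewrite mul1r divff ?Y1 // subr_eq0 eq_sym.
  have -> : #|F|%:R = \sum_(t : F) 1 :> algC by rewrite -sum1_card natr_sum.
  rewrite [in RHS](bigD1 0) //= [in RHS](bigD1 1) ?oner_neq0 //=.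
  by ring.
rewrite (eq_bigr (fun a => - (X a * Y a) - X a)) => [|a a1]; last first.
  have -> : \sum_(t | (t != 0) && (t != 1)) Y ((1 - a * t) / (1 - t)) =
      - Y a - 1.
    rewrite -(sum_mulcharD1 a hY y0 Yy) -(sum_moebius Y a1).
    rewrite [in RHS](bigD1 0) 1?eq_sym ?oner_neq0 //= mulr0 subr0 divr1 Y1.
    rewrite addrAC subrr add0r; apply: eq_bigl => t; exact: andbC.
  by rewrite mulrBr mulr1 mulrN.
rewrite sumrB sumrN (sum_mulcharD1 1 hXY z0 XYz) (sum_mulcharD1 1 hX x0 Xx).
by rewrite X1 Y1; ring.
Qed.

End MulChar.

(** * The cyclic group of exponents *)

Section Exponents.
Variables (n : nat).
Local Notation A := 'I_n.+1.
Implicit Types (al be s t : A) (m : int).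

(** The class of 1, a generator of the additive group of exponents. *)
Definition one_exp : A := inZp 1.
Local Notation g := one_exp.

Lemma Zp_mulr_eq0 s (k : nat) : (s *+ k == 0) = (n.+1 %| s * k)%N.
Proof. by rewrite Zp_mulrn -val_eqE. Qed.

Lemma Zp_mulrz_order s : s *~ n.+1 = 0.
Proof. by apply/eqP; rewrite -pmulrn Zp_mulr_eq0 dvdn_mull. Qed.

Section PrimRoot.
Variables (R : fieldType) (z : R) (hz : n.+1.-primitive_root z).

Lemma expZpMn s (k : nat) : z ^+ (s *+ k)%R = (z ^+ s) ^+ k.
Proof. by rewrite Zp_mulrn /= prim_expr_mod // exprM. Qed.

Lemma expZpD s t : z ^+ (s + t)%R = z ^+ s * z ^+ t.
Proof. by rewrite /= prim_expr_mod // exprD. Qed.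

Lemma expZp_neq0 s : z ^+ s != 0.
Proof. by rewrite expf_neq0 // (prim_root_eq0 hz). Qed.

Lemma expZpN s : z ^+ (- s)%R = (z ^+ s)^-1.
Proof.
apply: (mulfI (expZp_neq0 s)).
by rewrite -expZpD subrr divff ?expr0 ?expZp_neq0.
Qed.

Lemma expZpMz s m : z ^+ (s *~ m)%R = (z ^+ s) ^ m.
Proof.
case: m => m; first by rewrite -pmulrn expZpMn.
by rewrite NegzE mulrNz expZpN -pmulrn expZpMn exprnN.
Qed.

Lemma expZp_one : z ^+ g = z.
Proof. by rewrite /= prim_expr_mod. Qed.

Lemma expZp_inj s t : z ^+ s = z ^+ t -> s = t.
Proof.
move/eqP; rewrite (eq_prim_root_expr hz) !modn_small // => /eqP; exact: val_inj.
Qed.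

End PrimRoot.

Variables (om : algC) (hom : n.+1.-primitive_root om).

(** The pairing of the group of exponents with itself by roots of unity, which
    identifies it with its group of characters. *)
Definition chi al s : algC := om ^+ (al * s)%N.

Lemma chiC al s : chi al s = chi s al.
Proof. by rewrite /chi mulnC. Qed.

Lemma chiDl al be s : chi (al + be) s = chi al s * chi be s.
Proof. by rewrite /chi exprM expZpD // exprMn -!exprM. Qed.

Lemma chiDr al s t : chi al (s + t) = chi al s * chi al t.
Proof. by rewrite chiC chiDl !(chiC al). Qed.

Lemma chi0l s : chi 0 s = 1. Proof. by rewrite /chi mul0n expr0. Qed.
Lemma chi0r al : chi al 0 = 1. Proof. by rewrite chiC chi0l. Qed.

Lemma norm_chi al s : `|chi al s| = 1.
Proof.
rewrite normrX; suff -> : `|om| = 1 by rewrite expr1n.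
apply/eqP; rewrite -(@pexpr_eq1 _ _ n.+1) // -normrX.
by rewrite (prim_expr_order hom) normr1.
Qed.

Lemma chi_Mzl al s m : chi (al *~ m) s = chi al s ^ m.
Proof. by rewrite /chi !exprM expZpMz // exprnP exprz_exp mulrC -exprz_exp. Qed.

Lemma chi_Mz al s m : chi (al *~ m) s = chi al (s *~ m).
Proof. by rewrite chi_Mzl (chiC al (s *~ m)) chi_Mzl chiC. Qed.

Lemma chi_one_eq1 s : (chi g s == 1) = (s == 0).
Proof.
rewrite /chi exprM expZp_one // -(prim_order_dvd hom) -val_eqE /=.
apply/idP/eqP => [|->]; last exact: dvdn0.
by move/eqP; rewrite modn_small.
Qed.

Lemma one_expMz_eq0 m : (g *~ m == 0) = (n.+1 %| m)%Z.
Proof.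
have nat k : (g *+ k == 0) = (n.+1 %| k)%N.
  by rewrite Zp_mulr_eq0 -!/(dvdn _ _) /dvdn /= modnMml mul1n.
by case: m => m; rewrite ?NegzE ?mulrNz ?oppr_eq0 -pmulrn nat.
Qed.

(** A sum over a subgroup of a character which is not trivial on it vanishes. *)
Lemma sum_chi_eq0 (P : pred A) be s : (forall al, P (be + al) = P al) ->
  chi be s != 1 -> \sum_(al | P al) chi al s = 0.
Proof.
move=> Pbe be1; set S := \sum_(al | _) _.
have e : S = chi be s * S.
  rewrite /S mulr_sumr (reindex_inj (addrI be)) /=.
  by apply: eq_big => // al _; rewrite chiDl.
apply/eqP; have : (1 - chi be s) * S = 0 by rewrite mulrBl mul1r -e subrr.
by move/eqP; rewrite mulf_eq0 subr_eq0 eq_sym (negbTE be1).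
Qed.

Lemma sum_chi s : \sum_al chi al s = (s == 0)%:R * n.+1%:R.
Proof.
have [-> | s0] := eqVneq s 0.
  under eq_bigr do rewrite chi0r.
  by rewrite sumr_const card_ord mul1r.
by rewrite (@sum_chi_eq0 _ g) ?chi_one_eq1 // mul0r.
Qed.

Lemma card_torsion (d : nat) : (d %| n.+1)%N ->
  #|[pred al : A | al *+ d == 0]| = d.
Proof.
move=> dN; have d0 : (0 < d)%N by apply: dvdn_gt0 dN.
have c0 : (0 < n.+1 %/ d)%N by rewrite divn_gt0 // dvdn_leq.
pose h (l : 'I_d) : A := inord (l * (n.+1 %/ d)).
have hE l : h l = (l * (n.+1 %/ d))%N :> nat.
  by rewrite inordK // -[X in (_ < X)%N](divnK dN) mulnC ltn_pmul2l.
have h_inj : injective h.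
  move=> l l' /(congr1 val) /= /eqP; rewrite !hE eqn_pmul2r // => /eqP.
  exact: val_inj.
rewrite -[RHS]card_ord -(card_imset _ h_inj); apply: eq_card => al.
rewrite !inE Zp_mulr_eq0; apply/idP/imsetP => [|[l _ ->]]; last first.
  by rewrite hE -mulnA divnK // dvdn_mull.
rewrite -{1}(divnK dN) dvdn_pmul2r // => /dvdnP[l el].
have ld : (l < d)%N.
  by rewrite -(ltn_pmul2r c0) -el mulnC divnK.
by exists (Ordinal ld) => //; apply: val_inj; rewrite /= hE.
Qed.

Lemma sum_chi_torsion_nat (d : nat) m : (d %| n.+1)%N ->
  \sum_(al : A | al *+ d == 0) chi al (g *~ m) = (Dfun d m)%:~R.
Proof.
move=> dN; rewrite /Dfun; case: ifP => [/dvdzP[l ->] | dm].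
  rewrite (eq_bigr (fun=> 1)) ?sumr_const ?card_torsion // => al /eqP al0.
  by rewrite -chi_Mz mulrC mulrzA -pmulrn al0 mul0rz chi0l.
have d0 : (0 < d)%N by apply: dvdn_gt0 dN.
apply: (@sum_chi_eq0 _ (g *+ (n.+1 %/ d))) => [al|].
  by rewrite mulrnDl -mulrnA divnK // pmulrn Zp_mulrz_order add0r.
apply: contraFN dm; rewrite pmulrn chi_Mz chi_one_eq1 -mulrzA one_expMz_eq0.
have eN : n.+1%:Z = d%:Z * (n.+1 %/ d)%N%:Z by rewrite -PoszM mulnC divnK.
rewrite [X in (X %| _)%Z]eN dvdz_mul2r //.
by rewrite eqz_nat -lt0n divn_gt0 // dvdn_leq.
Qed.

Lemma Zp_mulrz_gcd al m m' :
  (al *~ gcdz m m' == 0) = (al *~ m == 0) && (al *~ m' == 0).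
Proof.
apply/idP/andP => [/eqP al0 | [/eqP al0 /eqP al0']].
  have sub k : (gcdz m m' %| k)%Z -> al *~ k == 0.
    by case/dvdzP=> l ->; rewrite mulrC mulrzA al0 mul0rz.
  by split; apply: sub; rewrite ?dvdz_gcdl ?dvdz_gcdr.
have [u [v <-]] := Bezoutz m m'.
by rewrite mulrzDr (mulrC u) (mulrC v) !mulrzA al0 al0' !mul0rz addr0.
Qed.

Lemma Zp_mulrz_gcd_order al m : (al *~ gcdz m n.+1 == 0) = (al *~ m == 0).
Proof. by rewrite Zp_mulrz_gcd Zp_mulrz_order eqxx andbT. Qed.

Lemma sum_chi_torsion m l :
  \sum_(al | al *~ m == 0) chi al (g *~ l) = (Dfun (gcdz m n.+1) l)%:~R.
Proof.
have -> : gcdz m n.+1 = `|gcdz m n.+1|%N by rewrite gez0_abs.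
rewrite -sum_chi_torsion_nat ?dvdn_gcdr //.
apply: eq_bigl => al; rewrite -(Zp_mulrz_gcd_order al m) pmulrn.
by rewrite gez0_abs.
Qed.

Lemma card_torsion_int m :
  #|[pred al : A | al *~ m == 0]|%:Z = gcdz m n.+1.
Proof.
have e : gcdz m n.+1 = `|gcdz m n.+1|%N by rewrite gez0_abs.
rewrite [RHS]e -[in RHS](@card_torsion `|gcdz m n.+1|%N) ?dvdn_gcdr //.
congr Posz; apply: eq_card => al.
by rewrite !inE -(Zp_mulrz_gcd_order al m) [gcdz _ _]e.
Qed.

(** * Integer 2 x 2 matrices acting on pairs of exponents *)

Lemma mulmx2E (M M' : 'M[int]_2) i j :
  (M *m M') i j = M i 0 * M' 0 j + M i 1 * M' 1 j.
Proof.
rewrite mxE big_ord_recl big_ord1.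
by congr (_ + _); congr (M _ _ * M' _ _); apply: val_inj.
Qed.

(** The row vector of exponents p times M. *)
Definition act2 (M : 'M[int]_2) (p : A * A) : A * A :=
  (p.1 *~ M 0 0 + p.2 *~ M 1 0, p.1 *~ M 0 1 + p.2 *~ M 1 1).

(** The pairs of exponents, as row vectors, that M sends to 0. *)
Definition ker2 (M : 'M[int]_2) : pred (A * A) := [pred p | act2 M p == 0].

Lemma act2_comp (M M' : 'M[int]_2) p : act2 (M *m M') p = act2 M' (act2 M p).
Proof.
rewrite /act2 /= !mulmx2E !mulrzDl !mulrzDr -!mulrzA.
by congr pair; rewrite -!addrA; congr (_ + _); rewrite addrCA.
Qed.

Lemma act2_1 p : act2 1%:M p = p.
Proof.
by case: p => al be; rewrite /act2 !mxE /= !mulr1z !mulr0z add0r addr0.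
Qed.

Lemma act2_0 M : act2 M 0 = 0.
Proof. by rewrite /act2 /= !mul0rz addr0. Qed.

(** Invertible changes of basis on either side preserve the number of
    solutions of p M = 0. *)
Lemma card_ker2_unit (L M R : 'M[int]_2) : L \in unitmx -> R \in unitmx ->
  #|ker2 (L *m M *m R)| = #|ker2 M|.
Proof.
move=> uL uR.
have actK X : X \in unitmx -> cancel (act2 X) (act2 (invmx X)).
  by move=> uX p; rewrite -act2_comp mulmxV ?act2_1.
rewrite -(cardsE (ker2 M)) -(card_preimset _ (can_inj (actK L uL))).
rewrite -cardsE; apply: eq_card => p; rewrite !inE !act2_comp.
by rewrite -[X in _ == X](act2_0 R) (can_eq (actK R uR)).
Qed.

Lemma card_ker2_diag (M : 'M[int]_2) : M 0 1 = 0 -> M 1 0 = 0 ->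
  #|ker2 M|%:Z = gcdz (M 0 0) n.+1 * gcdz (M 1 1) n.+1.
Proof.
move=> M01 M10; rewrite -!card_torsion_int -PoszM -cardX; congr Posz.
by apply: eq_card => p; rewrite !inE /act2 M01 M10 !mulr0z add0r addr0.
Qed.

End Exponents.

(** * The number of solutions of a homogeneous congruence *)

Lemma gcdn_mul_dvd (N x y : nat) : (x %| y)%N ->
  (gcdn x N * gcdn y N)%N = gcdn (N * gcdn x N) (x * y).
Proof.
move=> xy; rewrite muln_gcdr {1}muln_gcdl -gcdnA.
have /gcdn_idPr -> : (gcdn x N * N %| N * y)%N.
  by rewrite mulnC dvdn_mul // (dvdn_trans (dvdn_gcdl _ _)).
by rewrite gcdnC mulnC.
Qed.

Lemma ord2_ind (P : 'I_2 -> Prop) : P 0 -> P 1 -> forall i, P i.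
Proof.
move=> P0 P1 [[|[|//]] i_lt2].
  by rewrite (_ : Ordinal i_lt2 = 0) //; apply: val_inj.
by rewrite (_ : Ordinal i_lt2 = 1) //; apply: val_inj.
Qed.

(** The gcd of the entries, that is the first invariant factor of M. *)
Definition entry_gcd (M : 'M[int]_2) : int :=
  gcdz (gcdz (M 0 0) (M 0 1)) (gcdz (M 1 0) (M 1 1)).

Lemma dvdz_entry_gcdP (M : 'M[int]_2) x :
  reflect (forall i j, x %| M i j)%Z (x %| entry_gcd M)%Z.
Proof.
rewrite !dvdz_gcd; apply: (iffP idP) => [|h]; last by rewrite !h.
case/andP=> /andP[h00 h01] /andP[h10 h11] i j.
by elim/ord2_ind: i; elim/ord2_ind: j.
Qed.

Lemma dvdz_entry_gcd_mul (L M R : 'M[int]_2) :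
  (entry_gcd M %| entry_gcd (L *m M *m R))%Z.
Proof.
apply/dvdz_entry_gcdP => i j; have /dvdz_entry_gcdP h := dvdzz (entry_gcd M).
rewrite !mulmx2E; apply: rpredD; apply: dvdz_mulr; apply: rpredD.
all: exact: dvdz_mull.
Qed.

Lemma entry_gcd_unit (L M R : 'M[int]_2) : L \in unitmx -> R \in unitmx ->
  entry_gcd (L *m M *m R) = entry_gcd M.
Proof.
move=> uL uR; have := dvdz_entry_gcd_mul (invmx L) (L *m M *m R) (invmx R).
rewrite !mulmxA mulVmx // mul1mx mulmxK // => h.
have := dvdz_entry_gcd_mul L M R; rewrite /entry_gcd in h *.
by move=> h'; congr Posz; apply/eqP; rewrite eqn_dvd; apply/andP; split.
Qed.

Section CardKer.
Variable n : nat.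

(** For N = n + 1 this is gcd(s1, N) gcd(s2, N), where s1 | s2 are the invariant
    factors of M: s1 is the gcd of the entries and s1 s2 is the determinant up to
    sign. *)
Lemma card_ker2 (M : 'M[int]_2) : #|@ker2 n M|%:Z =
  gcdz (n.+1%:Z * gcdz (entry_gcd M) n.+1) (\det M).
Proof.
have [L uL [R uR [d d_sorted ->]]] := int_Smith_normal_form M.
set D := \matrix_(i, j) _.
rewrite card_ker2_unit // entry_gcd_unit // card_ker2_diag ?mxE //=.
have d01 : (d`_0 %| d`_1)%Z.
  by case: d d_sorted {D} => [|x [|y s]] //= /andP[].
have -> : entry_gcd D = absz (d`_0)%R.
  rewrite /entry_gcd !mxE /= !mulr1n !mulr0n gcdz0 gcd0z /gcdz !absz_nat.
  by have /gcdn_idPl -> : (absz (d`_0)%R %| absz (d`_1)%R)%N by [].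
have D_trig : is_trig_mx D.
  by apply/is_trig_mxP => r s rs; rewrite mxE ltn_eqF.
have abs1 (x : int) : x \is a GRing.unit -> `|x|%N = 1%N.
  by rewrite qualifE /= => /orP[] /eqP ->.
rewrite !det_mulmx (det_trig D_trig) big_ord_recl big_ord1 !mxE /= !mulr1n.
rewrite /gcdz !abszM !absz_nat (abs1 _ uL) (abs1 _ uR) mul1n muln1 -PoszM.
by congr Posz; apply: gcdn_mul_dvd.
Qed.

End CardKer.

(** * Counting points with characters *)

Lemma card_set_sum (T : finType) (P : pred T) :
  #|[set z | P z]|%:R = \sum_z (P z)%:R :> algC.
Proof.
rewrite cardsE -sum1_card natr_sum big_mkcond /=.
by apply: eq_bigr => z _; rewrite unfold_in; case: (P z).
Qed.

Section Count.
Variables (F : finFieldType) (n : nat) (hF : #|F| = n.+2).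
Variables (r : F) (hr : n.+1.-primitive_root r).
Variables (om : algC) (hom : n.+1.-primitive_root om).
Local Notation A := 'I_n.+1.
Local Notation chi := (@chi n om).
Local Notation g := (@one_exp n).
Implicit Types (al be s t : A) (x y : F).

Lemma exp_surj x : x != 0 -> exists s : A, x = r ^+ s.
Proof.
move=> x0; have x1 : x ^+ n.+1 = 1.
  by apply: (mulfI x0); rewrite -exprS -hF expf_card mulr1.
by have [s] := prim_rootP hr x1; exists s.
Qed.

(** The multiplicative character of F taking r ^+ s to chi al s. *)
Definition fchar al x : algC := \sum_(s : A | r ^+ s == x) chi al s.

Lemma fchar_exp al s : fchar al (r ^+ s) = chi al s.
Proof.
rewrite /fchar (big_pred1 s) // => t /=.
by apply/eqP/eqP => [/(expZp_inj hr)|->].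
Qed.

Lemma fchar0 al : fchar al 0 = 0.
Proof.
by rewrite /fchar big_pred0 // => s; rewrite (negbTE (expZp_neq0 hr s)).
Qed.

Lemma fchar1 al : fchar al 1 = 1.
Proof. by rewrite -[1 in LHS](expr0 r) (fchar_exp al 0) chi0r. Qed.

Lemma fchar_mulchar al : mulchar (fchar al).
Proof.
split; [exact: fchar0 | exact: fchar1 | move=> x y].
have [-> | /exp_surj[s ->]] := eqVneq x 0; first by rewrite mul0r fchar0 mul0r.
have [-> | /exp_surj[t ->]] := eqVneq y 0; first by rewrite mulr0 fchar0 mulr0.
by rewrite -expZpD // !fchar_exp chiDr.
Qed.

Lemma fchar_trivial x : x != 0 -> fchar 0 x = 1.
Proof. by case/exp_surj=> s ->; rewrite fchar_exp chi0l. Qed.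

Lemma fcharD al be x : fchar (al + be) x = fchar al x * fchar be x.
Proof.
have [-> | /exp_surj[s ->]] := eqVneq x 0; first by rewrite !fchar0 mul0r.
by rewrite !fchar_exp chiDl.
Qed.

Lemma fcharN al x : fchar (- al) x = fchar al x^-1.
Proof.
have [-> | x0] := eqVneq x 0; first by rewrite invr0 !fchar0.
rewrite (mulcharV _ (fchar_mulchar al)).
have al0 := mulchar_neq0 (fchar_mulchar al) x0.
by apply: (mulfI al0); rewrite -fcharD subrr fchar_trivial // divff.
Qed.

Lemma fchar_nontrivial al : al != 0 -> nontrivial_char (fchar al).
Proof.
move=> al0; exists r; first by rewrite (prim_root_eq0 hr).
have := fchar_exp al g; rewrite expZp_one // => ->.
by rewrite chiC chi_one_eq1.
Qed.

Local Notation J al be := (jacobi_sum (fchar al) (fchar be)).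

(** The function equal to J(al, be) on the three lines al = 0, be = 0 and
    al + be = 0 and to 0 off them, when r ^+ h = -1; note that q = n + 2. *)
Definition line_part (h al be : A) : algC :=
  n.+3%:R * ((al == 0) && (be == 0))%:R - (al == 0)%:R - (be == 0)%:R
  - (al + be == 0)%:R * chi al h.

(** The indicator function of the complement of the three lines; the origin,
    which lies on all of them, is subtracted three times and added back
    twice. *)
Definition off_lines al be : int :=
  1 - (al == 0)%:R - (be == 0)%:R - (al + be == 0)%:R
  + 2 * ((al == 0) && (be == 0))%:R.

Lemma jacobi_sum_off_lines (h al be : A) : r ^+ h = -1 ->
  `|J al be - line_part h al be| = sqrtC n.+2%:R * (off_lines al be)%:~R.
Proof.
move=> hh; rewrite /line_part /off_lines.
have vanish (z : algC) (G : int) : z = 0 -> G = 0 ->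
    `|z| = sqrtC n.+2%:R * G%:~R by move=> -> ->; rewrite normr0 mulr0.
have [-> | al0] := eqVneq al 0; have [-> | be0] := eqVneq be 0.
- rewrite addr0 eqxx chi0l; apply: vanish => //.
  have sumF : n.+2%:R = \sum_(t : F) 1 :> algC.
    by rewrite -hF -sum1_card natr_sum.
  rewrite -addn1 natrD sumF (bigD1 0) // (bigD1 1) ?oner_neq0 //=.
  rewrite /jacobi_sum (bigD1 0) //= fchar0 mul0r.
  rewrite (bigD1 1) ?oner_neq0 //= subrr fchar0 mulr0.
  rewrite (eq_bigr (fun=> 1)); first by ring.
  by move=> x /andP[x0 x1]; rewrite !fchar_trivial ?mulr1 // subr_eq0 eq_sym.
- rewrite add0r (negbTE be0); apply: vanish => //.
  have [-> _] := jacobi_sum1r fchar_trivial (fchar0 _) (fchar_mulchar be)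
                              (fchar_nontrivial be0).
  by rewrite /=; ring.
- rewrite addr0 (negbTE al0); apply: vanish => //.
  have [_ ->] := jacobi_sum1r fchar_trivial (fchar0 _) (fchar_mulchar al)
                              (fchar_nontrivial al0).
  by rewrite /=; ring.
have [e | albe0] := eqVneq (al + be) 0.
  apply: vanish => //.
  have -> : be = - al by apply/eqP; rewrite -addr_eq0 addrC e.
  rewrite (jacobi_sum_inv (fchar_mulchar al) (fchar_nontrivial al0)) /=.
    by rewrite -hh fchar_exp; ring.
  exact: fcharN.
rewrite /= mulr0 !subr0 mul0r !subr0 mulr1.
have [z z0 Xz] := fchar_nontrivial albe0.
apply: (@pexpIrn _ 2) => //; rewrite ?nnegrE ?normr_ge0 ?sqrtC_ge0 ?ler0n //.
rewrite sqrtCK -hF; apply: jacobi_sum_sqr_norm.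
- exact: fchar_mulchar.
- exact: fchar_mulchar.
- exact: fchar_nontrivial.
- exact: fchar_nontrivial.
by exists z; rewrite // -fcharD.
Qed.

(** Orthogonality: the characters of F detect the element r ^+ s. *)
Lemma indicator_fchar s x :
  (r ^+ s == x)%:R * n.+1%:R = \sum_al fchar al x * chi al (- s).
Proof.
have [-> | /exp_surj[t ->]] := eqVneq x 0.
  rewrite (negbTE (expZp_neq0 hr s)) mul0r big1 // => al _.
  by rewrite fchar0 mul0r.
under eq_bigr do rewrite fchar_exp -chiDr //.
rewrite sum_chi // subr_eq0 eq_sym; congr (_%:R * _); congr nat_of_bool.
by apply/eqP/eqP => [/(expZp_inj hr)|->].
Qed.

Lemma indicator_jacobi s t :
  (r ^+ s + r ^+ t == 1)%:R * n.+1%:R ^+ 2 =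
  \sum_al \sum_be J al be * (chi al (- s) * chi be (- t)).
Proof.
have -> : (r ^+ s + r ^+ t == 1)%:R =
    \sum_x (r ^+ s == x)%:R * (r ^+ t == 1 - x)%:R :> algC.
  rewrite (bigD1 (r ^+ s)) //= eqxx mul1r big1 ?addr0 => [|x xs]; last first.
    by rewrite eq_sym (negbTE xs) mul0r.
  by rewrite addrC -subr_eq opprK addrC eq_sym -subr_eq eq_sym.
rewrite mulr_suml.
under eq_bigr do rewrite expr2 mulrACA !indicator_fchar mulr_suml.
rewrite exchange_big; apply: eq_bigr => al _.
under eq_bigr do rewrite mulr_sumr.
rewrite exchange_big; apply: eq_bigr => be _.
by rewrite /jacobi_sum mulr_suml; apply: eq_bigr => x _; rewrite mulrACA.
Qed.

(** Summing over the points (s, t) keeps only the pairs of characters in the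
    kernel. *)
Lemma sum_chi_affine (M : 'M[int]_2) (c1 c2 : A) al be :
  \sum_(z : A * A) chi al (- (c1 + (z.1 *~ M 0 0 + z.2 *~ M 0 1))) *
                   chi be (- (c2 + (z.1 *~ M 1 0 + z.2 *~ M 1 1))) =
  chi al (- c1) * chi be (- c2) * ((ker2 M (al, be))%:R * n.+1%:R ^+ 2).
Proof.
have sumN ga : \sum_s chi ga (- s) = (ga == 0)%:R * n.+1%:R.
  rewrite -(sum_chi hom) (reindex_inj oppr_inj) /=.
  by apply: eq_bigr => s _; rewrite opprK chiC.
have -> : (ker2 M (al, be))%:R * n.+1%:R ^+ 2 =
    (\sum_s chi (al *~ M 0 0 + be *~ M 1 0) (- s)) *
    (\sum_t chi (al *~ M 0 1 + be *~ M 1 1) (- t)).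
  rewrite !sumN mulrACA -expr2 -natrM mulnb; congr (_%:R * _).
rewrite mulr_suml mulr_sumr.
under [RHS]eq_bigr do rewrite !mulr_sumr.
rewrite pair_big; apply: eq_bigr => -[s t] _ /=.
rewrite !opprD !chiDr // !chiDl // !chi_Mz // !mulNrz.
by ring.
Qed.

Lemma count_points (M : 'M[int]_2) (c1 c2 : A) :
  #|[set z : A * A | r ^+ (c1 + (z.1 *~ M 0 0 + z.2 *~ M 0 1))%R
                   + r ^+ (c2 + (z.1 *~ M 1 0 + z.2 *~ M 1 1))%R == 1]|%:R =
  \sum_(p | ker2 M p) chi p.1 (- c1) * chi p.2 (- c2) * J p.1 p.2.
Proof.
have N0 : n.+1%:R ^+ 2 != 0 :> algC by rewrite expf_neq0 // pnatr_eq0.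
apply: (mulIf N0); rewrite card_set_sum mulr_suml.
under eq_bigr do rewrite indicator_jacobi pair_big.
rewrite exchange_big mulr_suml [RHS]big_mkcond /=; apply: eq_bigr => -[al be] _.
rewrite -mulr_sumr sum_chi_affine /=.
case: ifP => _; last by rewrite mul0r !mulr0.
by rewrite mul1r mulrA [J _ _ * _]mulrC.
Qed.

End Count.

(** * The error term *)

(** Summing over a line of a product group, parametrised by l with left
    inverse pr. *)
Lemma sum_line (I J : finType) (P Q : pred J) (G : J -> algC)
    (l : I -> J) (pr : J -> I) :
  cancel l pr -> (forall p, Q p = (l (pr p) == p)) ->
  \sum_(p | P p) (Q p)%:R * G p = \sum_(s | P (l s)) G (l s).
Proof.
move=> lK QE.
have -> : \sum_(p | P p) (Q p)%:R * G p = \sum_(p | P p && Q p) G p.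
  rewrite big_mkcondr; apply: eq_bigr => p _.
  by case: (Q p); rewrite ?mul1r ?mul0r.
rewrite (reindex_onto l pr) => [|p /andP[_]]; last by rewrite QE => /eqP.
by apply: eq_bigl => s; rewrite QE lK !eqxx !andbT.
Qed.

Section Lines.
Variables (n : nat) (om : algC) (hom : n.+1.-primitive_root om).
Variable (M : 'M[int]_2).
Local Notation A := 'I_n.+1.
Local Notation g := (@one_exp n).
Local Notation N := (n.+1%:Z).
Local Notation ker := (@ker2 n M).
Local Notation chi2 p u v :=
  (@chi n om p.1 (g *~ u) * @chi n om p.2 (g *~ v)).

(** The constants d, e and f of the matrix M, with N = q - 1. *)
Definition gcd_d : int := gcdz (gcdz (M 0 0) (M 0 1)) N.
Definition gcd_e : int := gcdz (gcdz (M 1 0) (M 1 1)) N.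
Definition gcd_f : int := gcdz (gcdz (M 0 0 - M 1 0) (M 0 1 - M 1 1)) N.

Lemma sum_chi_line_d u v :
  \sum_(p | ker p) (p.2 == 0)%:R * chi2 p u v = (Dfun gcd_d u)%:~R.
Proof.
rewrite (@sum_line A _ ker (fun p => p.2 == 0) _ (fun s => (s, 0)) fst) //=;
  last first.
  by case=> s t /=; rewrite xpair_eqE eqxx eq_sym.
rewrite -(sum_chi_torsion hom); apply: eq_big => [s | s _].
  by rewrite Zp_mulrz_gcd /ker2 /act2 /= !mul0rz !addr0.
by rewrite chi0l mulr1.
Qed.

Lemma sum_chi_line_e u v :
  \sum_(p | ker p) (p.1 == 0)%:R * chi2 p u v = (Dfun gcd_e v)%:~R.
Proof.
rewrite (@sum_line A _ ker (fun p => p.1 == 0) _ (fun s => (0, s)) snd) //=;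
  last first.
  by case=> s t /=; rewrite xpair_eqE eqxx andbT eq_sym.
rewrite -(sum_chi_torsion hom); apply: eq_big => [s | s _].
  by rewrite Zp_mulrz_gcd /ker2 /act2 /= !mul0rz !add0r.
by rewrite chi0l mul1r.
Qed.

Lemma sum_chi_line_f u v :
  \sum_(p | ker p) (p.1 + p.2 == 0)%:R * chi2 p u v =
  (Dfun gcd_f (u - v))%:~R.
Proof.
rewrite (@sum_line A _ ker (fun p => p.1 + p.2 == 0) _ (fun s => (s, - s)) fst)
  //=; last first.
  by case=> s t /=; rewrite xpair_eqE eqxx addrC addr_eq0 eq_sym.
rewrite -(sum_chi_torsion hom); apply: eq_big => [s | s _].
  by rewrite Zp_mulrz_gcd /ker2 /act2 /= !mulrzBr !mulNrz.
by rewrite mulrzBr chiDr // -(mulrN1z s) chi_Mz // mulrN1z.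
Qed.

Lemma sum_chi_origin u v :
  \sum_(p | ker p) ((p.1 == 0) && (p.2 == 0))%:R * chi2 p u v = 1.
Proof.
rewrite (bigD1 (0, 0)) /=; last exact/eqP/act2_0.
rewrite !chi0l !mulr1 big1 ?addr0 // => -[s t] /andP[_].
by rewrite xpair_eqE => /negbTE /= ->; rewrite mul0r.
Qed.

(** The number of elements of the kernel off the three lines; the counts of the
    lines are the character sums above at exponent 0. *)
Lemma sum_off_lines :
  \sum_(p | ker p) (off_lines p.1 p.2)%:~R =
  (#|ker|%:Z - gcd_d - gcd_e - gcd_f + 2)%:~R :> algC.
Proof.
have chi1 (p : A * A) : chi2 p 0 0 = 1 by rewrite !mulr0z !chi0r mulr1.
have D0 (d : int) : Dfun d 0 = d by rewrite /Dfun dvdz0.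
have -> : \sum_(p | ker p) (off_lines p.1 p.2)%:~R =
    \sum_(p | ker p) (1 - (p.1 == 0)%:R * chi2 p 0 0
      - (p.2 == 0)%:R * chi2 p 0 0
      - (p.1 + p.2 == 0)%:R * chi2 p 0 0
      + 2 * (((p.1 == 0) && (p.2 == 0))%:R * chi2 p 0 0)).
  apply: eq_bigr => p _; rewrite chi1 !mulr1 /off_lines.
  by rewrite rmorphD !rmorphB rmorphM /= !rmorph_nat.
rewrite big_split !sumrB /= -mulr_sumr sum_chi_line_d sum_chi_line_e.
rewrite sum_chi_line_f sum_chi_origin subrr !D0 sumr_const.
by rewrite rmorphD !rmorphB /= -pmulrn; ring.
Qed.

End Lines.

Section Estimate.
Variables (F : finFieldType) (n : nat) (hF : #|F| = n.+2).
Variables (r : F) (hr : n.+1.-primitive_root r) (M : 'M[int]_2).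
Local Notation A := 'I_n.+1.
Local Notation g := (@one_exp n).

Lemma count_points_bound (i j w : int) : r ^ w = -1 ->
  `| #|[set z : A * A | r ^+ (g *~ i + (z.1 *~ M 0 0 + z.2 *~ M 0 1))%R
                  + r ^+ (g *~ j + (z.1 *~ M 1 0 + z.2 *~ M 1 1))%R == 1]|%:R
     - (n.+3%:Z - Dfun (gcd_d n M) i - Dfun (gcd_e n M) j
        - Dfun (gcd_f n M) (i - j + w))%:~R |
  <= sqrtC (n.+2%:R : algC) *
     (#|@ker2 n M|%:Z - gcd_d n M - gcd_e n M - gcd_f n M + 2)%:~R.
Proof.
move=> hw; have [om hom] := C_prim_root_exists (ltn0Sn n).
rewrite (count_points hF hr hom).
(* -w is also an exponent of -1; this choice makes the signs agree. *)
have hh : r ^+ (g *~ - w)%R = -1.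
  by rewrite expZpMz // expZp_one // -invr_expz hw invrN1.
set h := g *~ - w in hh.
have DN (l m : int) : Dfun l (- m) = Dfun l m by rewrite /Dfun rpredN.
have -> : (n.+3%:Z - Dfun (gcd_d n M) i - Dfun (gcd_e n M) j
    - Dfun (gcd_f n M) (i - j + w))%:~R =
    \sum_(p | @ker2 n M p) chi om p.1 (- (g *~ i)) * chi om p.2 (- (g *~ j))
      * line_part om h p.1 p.2.
  rewrite -!mulrNz.
  under eq_bigr => p _.
    have -> : chi om p.1 (g *~ - i) * chi om p.2 (g *~ - j)
        * line_part om h p.1 p.2 =
      n.+3%:R * (((p.1 == 0) && (p.2 == 0))%:R
                 * (chi om p.1 (g *~ - i) * chi om p.2 (g *~ - j)))
      - (p.1 == 0)%:R * (chi om p.1 (g *~ - i) * chi om p.2 (g *~ - j))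
      - (p.2 == 0)%:R * (chi om p.1 (g *~ - i) * chi om p.2 (g *~ - j))
      - (p.1 + p.2 == 0)%:R
        * (chi om p.1 (g *~ (- i - w)) * chi om p.2 (g *~ - j)).
      rewrite /line_part (mulrzDr _ (- i) (- w)) chiDr // -/h; ring.
    over.
  rewrite !sumrB -mulr_sumr sum_chi_origin sum_chi_line_d // sum_chi_line_e //.
  rewrite sum_chi_line_f // !DN.
  have -> : - i - w - - j = - (i - j + w) by ring.
  by rewrite DN !rmorphB /= -pmulrn; ring.
rewrite -sumrB.
under eq_bigr do rewrite -mulrBr.
rewrite -(sum_off_lines hom) mulr_sumr; apply: le_trans (ler_norm_sum _ _ _) _.
apply: ler_sum => p _; rewrite !normrM !norm_chi // !mul1r.
by rewrite (jacobi_sum_off_lines hF hr hom).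
Qed.

End Estimate.

(** * From the curve to pairs of exponents *)

Lemma intS_sub1 (k : nat) : k.+1%:Z - 1 = k.
Proof. by rewrite -addn1 PoszD addrK. Qed.

Section Curve.
Variables (F : finFieldType) (n : nat) (hF : #|F| = n.+2).
Variables (rho : {unit F}) (hrho : generator [set: {unit F}] rho).
Local Notation A := 'I_n.+1.
Local Notation g := (@one_exp n).
Local Notation r := (val rho).

Lemma order_generator : #[rho]%g = n.+1.
Proof. by rewrite /order -(eqP hrho) card_finField_unit hF. Qed.

Lemma prim_generator : n.+1.-primitive_root r.
Proof.
have rX1 m : r ^+ m = 1 -> (n.+1 %| m)%N.
  move=> e; rewrite -order_generator order_dvdn.
  by rewrite -val_eqE /= FinRing.val_unitX e.
have e : r ^+ n.+1 = 1.
  by rewrite -FinRing.val_unitX -order_generator expg_order.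
have [m hm mn] := prim_order_exists (ltn0Sn n) e.
suff -> : n.+1 = m by [].
by apply/eqP; rewrite eqn_dvd mn rX1 // (prim_expr_order hm).
Qed.

Lemma card_units : #|{: {unit F}}| = n.+1.
Proof. by rewrite -cardsT card_finField_unit hF. Qed.

(** The parametrisation of the torus by pairs of exponents. *)
Definition exp_pair (z : A * A) : {unit F} * {unit F} :=
  (rho ^+ z.1, rho ^+ z.2)%g.

Lemma exp_pair_bij : bijective exp_pair.
Proof.
apply: inj_card_bij => [[s t] [s' t'] [] /(congr1 val) e /(congr1 val) e'|].
  rewrite !FinRing.val_unitX in e e'.
  congr pair; exact: expZp_inj prim_generator _ _ _.
by rewrite !card_prod card_units card_ord.
Qed.

(** In the coordinates (s, t) with x = rho ^ s and y = rho ^ t, the equation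
    divided by its right-hand side. *)
Lemma card_curveC_exp (a : 'M[nat]_(3, 2)) (i j : int) : #|curveC rho a i j| =
  #|[set z : A * A |
       r ^+ (g *~ i + (z.1 *~ expB a 0 0 + z.2 *~ expB a 0 1))%R
       + r ^+ (g *~ j + (z.1 *~ expB a 1 0 + z.2 *~ expB a 1 1))%R == 1]|.
Proof.
rewrite -(on_card_preimset (onW_bij _ exp_pair_bij)).
apply: eq_card => -[s t]; rewrite !inE /= !FinRing.val_unitX.
have hr := prim_generator.
have r0 k : r ^+ k != 0 by rewrite expf_neq0 ?(prim_root_eq0 hr).
have expE m (u1 u2 v1 v2 : nat) :
    r ^+ (g *~ m + (s *~ (u1%:Z - v1%:Z) + t *~ (u2%:Z - v2%:Z)))%R *
      (r ^+ s ^+ v1 * r ^+ t ^+ v2) = r ^ m * r ^+ s ^+ u1 * r ^+ t ^+ u2.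
  rewrite !expZpD // !expZpMz // expZp_one // !expfzDr // -!exprnP -!exprnN.
  by field; rewrite -!exprM !r0.
have D0 : r ^+ s ^+ a ord_max 0 * r ^+ t ^+ a ord_max 1 != 0.
  by rewrite mulf_neq0 // expf_neq0.
rewrite !mxE.
rewrite (_ : lift ord_max 0 = 0 :> 'I_3); last exact: val_inj.
rewrite (_ : lift ord_max 1 = 1 :> 'I_3); last exact: val_inj.
by rewrite -[in RHS](inj_eq (mulIf D0)) mulrDl !expE mul1r.
Qed.

(** For q odd, rho ^ w is a square root of 1 other than 1; for q even, w = 0
    and -1 = 1. *)
Lemma generator_const_w : r ^ const_w n.+2 = -1.
Proof.
rewrite /const_w intS_sub1; case: ifP => q_odd; last first.
  have := expf_card (-1 : F); rewrite hF -signr_odd q_odd expr0.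
  by move=> <-; rewrite expr0z.
rewrite divz_nat divn2; set v := n.+1./2.
have vE : (v * 2)%N = n.+1.
  rewrite muln2 -[RHS](odd_double_half n.+1).
  by move: q_odd => /= /negbTE ->.
have /eqP : (r ^+ v) ^+ 2 = 1.
  by rewrite -exprM vE (prim_expr_order prim_generator).
rewrite sqrf_eq1 => /orP[|/eqP //].
rewrite -(prim_order_dvd prim_generator) -vE -{2}[v]muln1 dvdn_pmul2l //.
by case: (v) vE.
Qed.

(** Modulo gcd(d, e) the entries of M vanish, so f is a multiple of it. *)
Lemma gcd_lines (M : 'M[int]_2) :
  gcdz (gcdz (gcd_d n M) (gcd_e n M)) (gcd_f n M) = gcdz (entry_gcd M) n.+1.
Proof.
have /gcdz_idPl -> : (gcdz (gcd_d n M) (gcd_e n M) %| gcd_f n M)%Z.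
  set G := gcdz _ _.
  have Gd : (G %| gcd_d n M)%Z := dvdz_gcdl _ _.
  have Ge : (G %| gcd_e n M)%Z := dvdz_gcdr _ _.
  move: Gd Ge; rewrite !dvdz_gcd.
  move=> /andP[/andP[h00 h01] ->] /andP[/andP[h10 h11] _].
  by rewrite !rpredB.
by rewrite gez0_abs // /gcd_d /gcd_e gcdzACA gcdzz.
Qed.

Lemma Nerr_bound (a : 'M[nat]_(3, 2)) (i j : int) :
  `|(Nerr rho a i j)%:~R : algC| <=
  sqrtC n.+2%:R * (const_k n.+2 a - const_d n.+2 a - const_e n.+2 a
                   - const_f n.+2 a + 2)%:~R.
Proof.
have := count_points_bound hF prim_generator (expB a) i j generator_const_w.
rewrite -card_curveC_exp /Nerr /mainterm hF pmulrn -rmorphB /=.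
rewrite card_ker2 -gcd_lines /const_k /const_d /const_e /const_f intS_sub1.
have -> : n.+2%:Z + 1 = n.+3%:Z by rewrite -PoszD addn1.
by [].
Qed.

End Curve.

(** * The bound *)

(** Comparing squares of integers moves the bound from the algebraic numbers to
    any real closed field; the hypothesis forces the right-hand side to be
    nonnegative. *)
Lemma ler_sqrt_transfer (R : rcfType) (q : nat) (x c : int) :
  `|x%:~R : algC| <= sqrtC q%:R * c%:~R ->
  `|x|%:~R <= c%:~R * Num.sqrt q%:R :> R.
Proof.
move=> h.
have [c0 | c_lt0] := leP 0 c; last first.
  have [q0 | q0] := posnP q.
    move: h; rewrite q0 !mulr0n sqrtC0 mul0r normr_le0 intr_eq0 => /eqP ->.
    by rewrite sqrtr0 mulr0 normr0.
  have : sqrtC q%:R * c%:~R < 0 :> algC.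
    by rewrite pmulr_rlt0 ?sqrtC_gt0 ?ltr0n // ltrz0.
  by move/(le_lt_trans h); rewrite normr_lt0.
have sq : `|x| ^+ 2 <= q%:Z * c ^+ 2.
  have : (`|x%:~R : algC|) ^+ 2 <= (sqrtC q%:R * c%:~R) ^+ 2.
    rewrite ler_pXn2r // nnegrE ?normr_ge0 //.
    by rewrite mulr_ge0 ?sqrtC_ge0 ?ler0n ?ler0z.
  rewrite exprMn sqrtCK -intr_norm -!rmorphXn /= pmulrn -rmorphM ler_int.
  by [].
rewrite -(@ler_pXn2r _ 2) ?nnegrE ?mulr_ge0 ?sqrtr_ge0 ?ler0z //.
rewrite exprMn sqr_sqrtr ?ler0n // -!rmorphXn /= pmulrn -rmorphM ler_int.
by rewrite mulrC.
Qed.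

Theorem corollary2p3 (R : rcfType) (p n : nat) (hp : prime p) (hn : (0 < n)%N)
    (F : finFieldType) (hF : #|F| = (p ^ n)%N)
    (rho : {unit F}) (hrho : generator [set: {unit F}] rho)
    (a : 'M[nat]_(3, 2)) (ha : noncollinear a) (i j : int) :
  `| Nerr rho a i j |%:~R <= 2 * ratr (gtilde (p ^ n) a) * Num.sqrt (p ^ n)%:R
  :> R.
Proof.
have [m hm] : exists m, #|F| = m.+2.
  by have := card_finNzRing_gt1 F; case: #|F| => [|[|m]] // _; exists m.
rewrite -hF hm /gtilde; set c := const_k _ _ - _ - _ - _ + _.
have -> : 2 * ratr (c%:~R / 2) = c%:~R :> R.
  by rewrite fmorph_div /= ratr_int rmorph_nat mulrC divfK // pnatr_eq0.
exact/ler_sqrt_transfer/(Nerr_bound hm hrho).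
Qed.
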